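(* Let $m\in\mathbb{N}$, let $a_1,\dots,a_m\in\mathbb{C}$ with $a_1\neq 0$, let $P(s)=\sum_{k=1}^{m} a_k k^{-s}$, and let $r\in\mathbb{R}$. For $n\in\mathbb{N}$ define $d_{n,r}\ge 0$ by $$ d_{n,r}^2=\inf_{b_1,\ldots,b_n\in \mathbb{C}}\int_0^\infty \left|\mathbf{1}_{(0,1)}(x)-\sum_{k=1}^n b_k\, \kappa_r\left(\frac{1}{kx}\right)\right|^2 dx . $$ Then $$ \liminf_{n\to\infty}\ d_{n,r}^2\,\log n\ \ge\ C,\qquad C=\sum_{\Re(\rho_P)=r}\frac{1}{|\rho_P-r+1/2|^2}, $$ where the sum is over the distinct zeros $\rho_P$ of $P(s)$ lying on the line $\Re(s)=r$, and $C=0$ if $P$ has no zeros on $\Re(s)=r$.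
   Context: For the Dirichlet polynomial $P(s)=\sum_{k=1}^{m} a_k k^{-s}$ (a function of the complex variable $s$) and $r\in\mathbb{R}$, the function $\kappa_r:(0,\infty)\to\mathbb{C}$ is defined by $$\kappa_r(x)=\sum_{k\le x}\frac{a_k}{k^{\,r-1/2}},$$ where the sum is over positive integers $k\le x$, with the convention $a_k=0$ for $k>m$ (so $\kappa_r(x)=0$ for $0<x<1$). $\mathbf{1}_{(0,1)}$ is the characteristic function of the interval $(0,1)$. The limit inferior is taken in $[0,+\infty]$. *)

(* Defs.v *)
(* MathComp-Analysis, over an arbitrary realType R; complex numbers are R[i]. *)
From mathcomp Require Import all_boot all_order all_algebra.
From mathcomp Require Import complex.
From mathcomp Require Import all_classical all_reals all_analysis.

Set Implicit Arguments.
Unset Strict Implicit.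
Unset Printing Implicit Defensive.
Import Order.TTheory GRing.Theory Num.Theory.
Import numFieldNormedType.Exports.

Local Open Scope classical_set_scope.
Local Open Scope ring_scope.
Local Open Scope complex_scope.

Definition cexp (R : realType) (z : R[i]) : R[i] :=
  (expR (complex.Re z))%:C * (cos (complex.Im z) +i* sin (complex.Im z)).

(* k^z for an integer k >= 1, with the real logarithm of k. *)
Definition natcpow (R : realType) (k : nat) (z : R[i]) : R[i] :=
  cexp (z * (ln k%:R)%:C).

(* Coefficients a_1, ..., a_m (and b_1, ..., b_n below) are the values of a
   sequence at the indices 1, ..., m; the other values are never used. *)
Definition dirichlet_poly (R : realType) (m : nat) (a : nat -> R[i])
    (s : R[i]) : R[i] :=
  \sum_(1 <= k < m.+1) a k * natcpow k (- s).

Definition kappa (R : realType) (m : nat) (a : nat -> R[i]) (r x : R) : R[i] :=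
  \sum_(1 <= k < m.+1 | k%:R <= x) a k / (k%:R `^ (r - 2^-1))%:C.

Definition sq_error (R : realType) (m : nat) (a : nat -> R[i]) (r : R)
    (n : nat) (b : nat -> R[i]) : \bar R :=
  (\int[lebesgue_measure]_(x in `]0%R, +oo[)
     (ComplexField.Normc.normc
        ((\1_(`]0, 1[ : set R) x)%:C
         - \sum_(1 <= k < n.+1) b k * kappa m a r (k%:R * x)^-1) ^+ 2)%:E)%E.

Definition approx_dist (R : realType) (m : nat) (a : nat -> R[i]) (r : R)
    (n : nat) : \bar R :=
  sqrte (ereal_inf [set sq_error m a r n b | b in [set: nat -> R[i]]]).

Lemma approx_dist_ge0 (R : realType) (m : nat) (a : nat -> R[i]) (r : R)
    (n : nat) :
  (0 <= approx_dist m a r n)%E.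
Proof. exact: sqrte_ge0. Qed.

Lemma approx_dist_sqr (R : realType) (m : nat) (a : nat -> R[i]) (r : R)
    (n : nat) :
  (approx_dist m a r n ^+ 2 =
   ereal_inf [set sq_error m a r n b | b in [set: nat -> R[i]]])%E.
Proof.
rewrite /approx_dist sqr_sqrte//; apply: le_ereal_inf_tmp => _ [b _ <-].
by apply: integral_ge0 => x _; rewrite lee_fin sqr_ge0.
Qed.

Definition zeros_on_line (R : realType) (m : nat) (a : nat -> R[i]) (r : R) :
    set R[i] :=
  [set rho | dirichlet_poly m a rho = 0 /\ complex.Re rho = r].

(* An unordered sum of nonnegative terms in [0, +oo]; it is 0 over set0. *)
Definition zero_const (R : realType) (m : nat) (a : nat -> R[i]) (r : R) :
    \bar R :=
  (\esum_(rho in zeros_on_line m a r)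
     ((ComplexField.Normc.normc (rho - r%:C + (2^-1)%:C) ^+ 2)^-1)%:E)%E.

(* Main.v *)
(* The distance is bounded below by weak duality: for every square-integrable
   h and real t, ||g||^2 >= 2 t Re <g, h> - t^2 ||h||^2. If P(r + i gamma) = 0
   and q = 1/2 + i gamma, then x^(q-1) integrates to 0 against every
   kappa_r(1/(k x)), since the Mellin transform of the latter on the critical
   line is k^-q P(r + i gamma) / q. As kappa_r(1/(k x)) is constant near 0
   for k <= n, the functions x^(q-1) may be replaced on ]0, e], e = 1/(n(m+1)),
   by constants with the same integral, which makes them square-integrable.
   The test function is the sum of the x^(q-1) / conj(q) over finitely many
   zeros, truncated in this way: its pairing with the error is exactly
   C = sum |q|^-2, and, the cross terms x^(i(gamma-gamma')-1) having bounded
   integrals over ]e, 1], its squared norm is at most C ln n + O(1).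
   Optimizing t gives d_n^2 >= C^2 / (C ln n + O(1)). *)
Require Import Defs.
From mathcomp Require Import all_boot all_order all_algebra.
From mathcomp Require Import complex.
From mathcomp Require Import all_classical all_reals all_analysis.
From mathcomp Require Import ring lra.

Set Implicit Arguments.
Unset Strict Implicit.
Unset Printing Implicit Defensive.

Import Order.TTheory GRing.Theory Num.Theory.
Import numFieldNormedType.Exports.

Local Open Scope ring_scope.
Local Open Scope complex_scope.
Local Open Scope classical_set_scope.

Local Notation normc := ComplexField.Normc.normc.
(** The right end is open for [b = true] and closed for [b = false]: the target 1_(0,1) is open at
    1, while the steps of kappa_r(1/(k x)) are closed. The left end is open, so the interval stays
    inside the half line even for e = 0. *)
Local Notation ind e b y :=
  (fun x => (\1_[set` Interval (BRight e) (BSide b y)] x)%:C).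

(** The limit inferior is the supremum of the tail infima, and [l] bounds the tail at [N] from
    below. *)
Lemma limn_einf_ge (R : realType) (u : nat -> \bar R) (l : \bar R) (N : nat) :
  (forall n, (N <= n)%N -> (l <= u n)%E) -> (l <= limn_einf u)%E.
Proof.
move=> lu; rewrite limn_einf_lim.
apply: (@le_trans _ _ (einfs u N)).
  by apply: le_ereal_inf_tmp => _ [n /= Nn <-]; exact: lu.
by rewrite (cvg_lim _ (@cvg_einfs_sup R u))//; apply: ereal_sup_ubound; exists N.
Qed.

(** * Real and complex integrals over the half line with known values *)

Section HasIntegral.
Variable R : realType.
Implicit Types (f g F : R -> R) (v : R) (h k : R -> R[i]) (w z : R[i]).

(** Integrability travels with the value, so linear combinations need no separate side
    conditions. *)
Definition has_int f v :=
  lebesgue_measure.-integrable (`]0, +oo[ : set R) (EFin \o f) /\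
  (\int[lebesgue_measure]_(x in `]0%R, +oo[) (f x)%:E = v%:E)%E.

Lemma has_int_eq f g v :
  (forall x, 0 < x -> f x = g x) -> has_int f v -> has_int g v.
Proof.
move=> fg [fi fv]; split.
  apply: eq_integrable fi => // x; rewrite inE/= in_itv/= andbT => x0.
  by rewrite fg.
rewrite -fv; apply: eq_integral => x; rewrite inE/= in_itv/= andbT => x0.
by rewrite fg.
Qed.

Lemma has_int0 : has_int (fun=> 0) 0.
Proof. by split; [exact: integrable0|rewrite integral0]. Qed.

Lemma has_intD f g u v :
  has_int f u -> has_int g v -> has_int (fun x => f x + g x) (u + v).
Proof.
move=> [fi fu] [gi gv]; split.
  exact: (integrableD _ fi gi).
by rewrite EFinD -fu -gv -integralD_EFin.
Qed.

Lemma has_intZ c f v : has_int f v -> has_int (fun x => c * f x) (c * v).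
Proof.
move=> [fi fv]; split; first exact: (integrableZl _ c fi).
by rewrite EFinM -fv -(integralZl _ fi).
Qed.

(** The integral of a nonnegative function is a supremum over the simple functions below it, hence
    monotone for arbitrary [p]. The squared error can thus be bounded below by a purely pointwise
    comparison. *)
Lemma has_int_le_integral f (p : R -> R) v : has_int f v ->
  (forall x, 0 <= p x) -> (forall x, 0 < x -> f x <= p x) ->
  (v%:E <= \int[lebesgue_measure]_(x in `]0%R, +oo[) (p x)%:E)%E.
Proof.
move=> [fi <-] p0 fp; rewrite integralE.
apply: (@le_trans _ _ (\int[lebesgue_measure]_(x in `]0%R, +oo[)
    ((EFin \o f)^\+ x))%E).
  by rewrite leeBlDr ?integrable_neg_fin_num// leeDl// integral_ge0.
rewrite ge0_integralE// ge0_integralE; last by move=> x _; rewrite lee_fin.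
apply: le_ereal_sup => _ [h hf <-]; exists h => // x.
apply: le_trans (hf x) _; rewrite !patchE; case: ifPn => //.
rewrite inE/= in_itv/= andbT => x0.
by rewrite funeposE ge_max !lee_fin p0 fp.
Qed.

Lemma has_int_FTC f F (e y : R) (b : bool) : 0 <= e -> e <= y ->
  (forall x, e <= x -> is_derive x 1 F (f x)) ->
  (forall x, e <= x -> derivable f x 1) ->
  has_int (fun x => \1_[set` Interval (BRight e) (BSide b y)] x * f x)
          (F y - F e).
Proof.
move=> e0 ey dF df.
set I := [set` _].
have mI : measurable I by exact: measurable_itv.
have ID : `]0, +oo[%classic `&` I = I.
  rewrite setIC; apply/setIidPl => x; rewrite /I /= !in_itv/= => /andP[ex _].
  by rewrite andbT (le_lt_trans e0).
have fE : (fun x => (\1_I x * f x)%:E) = (EFin \o f) \_ I.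
  apply/funext => x; rewrite patchE indicE; case: ifPn => xI.
    by rewrite mul1r.
  by rewrite mul0r.
have cf : {within `[e, y], continuous f}.
  apply: derivable_within_continuous => x; rewrite in_itv/= => /andP[ex _].
  exact: df.
have cF x : e <= x -> {for x, continuous F}.
  move=> ex; apply/differentiable_continuous/derivable1_diffP.
  by have [] := dF x ex.
have intf : lebesgue_measure.-integrable `[e, y] (EFin \o f).
  by apply: continuous_compact_integrable => //; exact: segment_compact.
have IS : I `<=` `[e, y].
  by move=> x; rewrite /I /= !in_itv/=; case: (b) => /= /andP[/ltW -> // /ltW].
have intfI : lebesgue_measure.-integrable I (EFin \o f).
  by apply: (@integrableS _ _ _ (@lebesgue_measure R) _ I _ _ _ IS intf); exact: measurable_itv.
split.
  rewrite [X in integrable _ _ X]fE; apply/integrable_restrict => //.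
  by rewrite ID.
rewrite fE -integral_mkcondr ID.
(* For e = y the interval is empty; the fundamental theorem of calculus is applied only for e <
   y. *)
move: ey; rewrite le_eqVlt => /predU1P[ey|ey].
  rewrite /I -ey subrr set_itv_ge ?integral_set0// -leNgt.
  by case: (b); rewrite bnd_simp.
(* Endpoints are null sets: pass from [I] to ]e, y[, then to [e, y]. *)
rewrite integral_itv_bndoo; last first.
  apply: measurable_funS (measurable_int _ intf) => //.
  exact: subset_itv_oo_cc.
rewrite -(@integral_itv_bndoo _ _ _ _ true false); last first.
  apply: measurable_funS (measurable_int _ intf) => //.
  exact: subset_itv_oo_cc.
rewrite (continuous_FTC2 (F := F))//.
- split.
  + move=> x; rewrite in_itv/= => /andP[/ltW ex _].
    by have [] := dF x ex.
  + exact/cvg_at_right_filter/cF.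
  + exact/cvg_at_left_filter/cF/ltW.
- move=> x; rewrite in_itv/= => /andP[/ltW ex _].
  by rewrite derive1E; have [_ ->] := dF x ex.
Qed.

Definition has_cint h w :=
  has_int (fun x => complex.Re (h x)) (complex.Re w) /\
  has_int (fun x => complex.Im (h x)) (complex.Im w).

Lemma has_cint_eq h k w :
  (forall x, 0 < x -> h x = k x) -> has_cint h w -> has_cint k w.
Proof.
by move=> hk [hr hi]; split; [apply: has_int_eq hr|apply: has_int_eq hi];
  move=> x x0; rewrite hk.
Qed.

Lemma complexReD w z : complex.Re (w + z) = complex.Re w + complex.Re z.
Proof. by case: w z => [? ?] [? ?]. Qed.

Lemma complexImD w z : complex.Im (w + z) = complex.Im w + complex.Im z.
Proof. by case: w z => [? ?] [? ?]. Qed.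

Lemma complexReM w z : complex.Re (w * z) =
  complex.Re w * complex.Re z - complex.Im w * complex.Im z.
Proof. by case: w z => [? ?] [? ?]. Qed.

Lemma complexImM w z : complex.Im (w * z) =
  complex.Re w * complex.Im z + complex.Im w * complex.Re z.
Proof. by case: w z => [? ?] [? ?]. Qed.

Lemma has_cint0 : has_cint (fun=> 0) 0.
Proof. by split; exact: has_int0. Qed.

Lemma has_cintD h k w z :
  has_cint h w -> has_cint k z -> has_cint (fun x => h x + k x) (w + z).
Proof.
move=> [hr hi] [kr ki]; split.
  by rewrite complexReD; apply: has_int_eq (has_intD hr kr) => x _; rewrite complexReD.
by rewrite complexImD; apply: has_int_eq (has_intD hi ki) => x _; rewrite complexImD.
Qed.

Lemma has_cintZ z h w : has_cint h w -> has_cint (fun x => z * h x) (z * w).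
Proof.
move=> [hr hi]; split.
  rewrite complexReM -mulNr.
  apply: has_int_eq (has_intD (has_intZ (complex.Re z) hr)
    (has_intZ (- complex.Im z) hi)) => x _.
  by rewrite complexReM mulNr.
rewrite complexImM.
apply: has_int_eq (has_intD (has_intZ (complex.Re z) hi)
  (has_intZ (complex.Im z) hr)) => x _.
by rewrite complexImM.
Qed.

Lemma has_cint_sum (I : eqType) (s : seq I) (P : pred I) (h : I -> R -> R[i])
    (w : I -> R[i]) :
  (forall i, i \in s -> P i -> has_cint (h i) (w i)) ->
  has_cint (fun x => \sum_(i <- s | P i) h i x) (\sum_(i <- s | P i) w i).
Proof.
elim: s => [_|i s ih hw].
  by rewrite big_nil; apply: has_cint_eq has_cint0 => x _; rewrite big_nil.
have {}ih : has_cint (fun x => \sum_(i <- s | P i) h i x)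
    (\sum_(i <- s | P i) w i).
  by apply: ih => j js; apply: hw; rewrite inE js orbT.
rewrite big_cons; case: ifPn => Pi.
  apply: has_cint_eq (has_cintD (hw i (mem_head _ _) Pi) ih) => x _.
  by rewrite big_cons Pi.
by apply: has_cint_eq ih => x _; rewrite big_cons (negbTE Pi).
Qed.

End HasIntegral.

(** * Complex powers of positive reals and their integrals *)

Section ComplexPower.
Variable R : realType.
Implicit Types (x y e : R) (z w : R[i]).

Lemma cexpD z w : cexp (z + w) = cexp z * cexp w.
Proof.
case: z w => [a b] [c d]; rewrite /cexp /= expRD cosD sinD.
by apply/eqP; rewrite eq_complex /=; apply/andP; split; apply/eqP; ring.
Qed.

Lemma cexp_real x : cexp x%:C = (expR x)%:C.
Proof. by rewrite /cexp /= cos0 sin0 complexr0 mulr1. Qed.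

Lemma cexp_conj z : conjc (cexp z) = cexp (conjc z).
Proof.
case: z => a b; rewrite /cexp /= cosN sinN.
by apply/eqP; rewrite eq_complex /= !mul0r ?mulr0 !subr0 !addr0 mulrN !eqxx.
Qed.

(** The power x^z for x > 0, with the real logarithm; at [k%:R] it unfolds to the same term as
    [natcpow k z]. *)
Definition xpow x z : R[i] := cexp (z * (ln x)%:C).

Lemma xpowD x z w : xpow x (z + w) = xpow x z * xpow x w.
Proof. by rewrite /xpow mulrDl cexpD. Qed.

Lemma xpowM x y z : 0 < x -> 0 < y -> xpow (x * y) z = xpow x z * xpow y z.
Proof. by move=> x0 y0; rewrite /xpow lnM ?posrE// rmorphD mulrDr cexpD. Qed.

Lemma xpow1 z : xpow 1 z = 1.
Proof. by rewrite /xpow ln1 mulr0 cexp_real expR0. Qed.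

Lemma xpow_conj x z : conjc (xpow x z) = xpow x (conjc z).
Proof. by rewrite /xpow cexp_conj rmorphM /= oppr0. Qed.

Lemma xpow_real x y : 0 < x -> xpow x y%:C = (x `^ y)%:C.
Proof.
by move=> x0; rewrite /xpow -rmorphM cexp_real /powR gt_eqF.
Qed.

Lemma xpowV x z : 0 < x -> xpow x^-1 z = xpow x (- z).
Proof. by move=> x0; rewrite /xpow lnV ?posrE// rmorphN mulrN mulNr. Qed.

Lemma xpowN1 x : 0 < x -> xpow x (-1) = x^-1%:C.
Proof.
move=> x0; rewrite -(rmorph1 (real_complex R)) -rmorphN xpow_real//.
by rewrite powRN powRr1// ltW.
Qed.

Lemma xpowB1 x z : 0 < x -> xpow x (z - 1) = x^-1%:C * xpow x z.
Proof. by move=> x0; rewrite xpowD xpowN1// mulrC. Qed.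

Lemma xpow_conjM x z : 0 < x ->
  xpow x z * conjc (xpow x z) = (x `^ (2 * complex.Re z))%:C.
Proof.
move=> x0; rewrite xpow_conj -xpowD -xpow_real//; congr (xpow _ _).
by case: z => a b; apply/eqP; rewrite eq_complex /= subrr eqxx andbT; apply/eqP; ring.
Qed.

(** The rule d/dt t^z = z t^(z-1), checked on the components e^(u ln t) cos(v ln t) and e^(u ln t)
    sin(v ln t), where z = u + iv. *)
Lemma is_derive_xpow x z : 0 < x ->
  is_derive x 1 (fun t => complex.Re (xpow t z))
    (complex.Re (z * xpow x (z - 1))) /\
  is_derive x 1 (fun t => complex.Im (xpow t z))
    (complex.Im (z * xpow x (z - 1))).
Proof.
move=> x0; case: z => u v.
have dl (c : R) : is_derive x 1 (fun t => c * ln t) (c * x^-1).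
  have := is_derive1_ln x0; move=> d.
  exact: is_deriveZ.
have dE : is_derive x 1 (fun t => expR (u * ln t)) (expR (u * ln x) * (u * x^-1)).
  exact: (@is_derive1_comp _ expR (fun t => u * ln t)).
have dC : is_derive x 1 (fun t => cos (v * ln t)) (- sin (v * ln x) * (v * x^-1)).
  exact: (@is_derive1_comp _ cos (fun t => v * ln t)).
have dS : is_derive x 1 (fun t => sin (v * ln t)) (cos (v * ln x) * (v * x^-1)).
  exact: (@is_derive1_comp _ sin (fun t => v * ln t)).
have xE t : xpow t (u +i* v) =
    (expR (u * ln t) * cos (v * ln t)) +i* (expR (u * ln t) * sin (v * ln t)).
  rewrite /xpow /cexp /= !mulr0 subr0 add0r.
  by apply/eqP; rewrite eq_complex /= !mul0r subr0 addr0 !eqxx.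
rewrite xpowB1// xE; split.
  under eq_fun do rewrite xE /=.
  apply: is_derive_eq (is_deriveM dE dC) _.
  by rewrite /= /GRing.scale /=; ring.
under eq_fun do rewrite xE /=.
apply: is_derive_eq (is_deriveM dE dS) _.
by rewrite /= /GRing.scale /=; ring.
Qed.

Lemma derivable_xpow x z w : 0 < x ->
  derivable (fun t => complex.Re (w * xpow t z)) x 1 /\
  derivable (fun t => complex.Im (w * xpow t z)) x 1.
Proof.
move=> /(is_derive_xpow z)[dR dI].
have dr := @ex_derive _ _ _ _ _ _ _ dR.
have di := @ex_derive _ _ _ _ _ _ _ dI.
split.
  have -> : (fun t => complex.Re (w * xpow t z)) = (fun t =>
      complex.Re w * complex.Re (xpow t z) - complex.Im w * complex.Im (xpow t z)).
    by apply/funext => t; exact: complexReM.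
  exact: (derivableB (derivableZ dr) (derivableZ di)).
have -> : (fun t => complex.Im (w * xpow t z)) = (fun t =>
    complex.Re w * complex.Im (xpow t z) + complex.Im w * complex.Re (xpow t z)).
  by apply/funext => t; exact: complexImM.
exact: (derivableD (derivableZ di) (derivableZ dr)).
Qed.

Lemma complexReCM x z : complex.Re (x%:C * z) = x * complex.Re z.
Proof. by rewrite complexReM /= mul0r subr0. Qed.

Lemma complexImCM x z : complex.Im (x%:C * z) = x * complex.Im z.
Proof. by rewrite complexImM /= mul0r addr0. Qed.

Lemma has_cint_xpow z e y (b : bool) : z != 0 -> 0 < e -> e <= y ->
  has_cint (fun x => ind e b y x * xpow x (z - 1)) ((xpow y z - xpow e z) / z).
Proof.
move=> z0 e0 ey.
have xpos x : e <= x -> 0 < x by exact: lt_le_trans.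
suff hz : has_cint (fun x => ind e b y x * (z * xpow x (z - 1)))
    (xpow y z - xpow e z).
  rewrite [_ / _]mulrC; apply: has_cint_eq (has_cintZ z^-1 hz) => x _.
  by rewrite mulrCA mulKf.
split; rewrite ?(complexReD, complexImD).
  apply: has_int_eq (has_int_FTC b (ltW e0) ey
    (fun x ex => (is_derive_xpow z (xpos x ex)).1)
    (fun x ex => (derivable_xpow (z - 1) z (xpos x ex)).1)) => x _.
  by rewrite complexReCM.
apply: has_int_eq (has_int_FTC b (ltW e0) ey
  (fun x ex => (is_derive_xpow z (xpos x ex)).2)
  (fun x ex => (derivable_xpow (z - 1) z (xpos x ex)).2)) => x _.
by rewrite complexImCM.
Qed.

Lemma has_cint_real (f : R -> R) (v : R) :
  has_int f v -> has_cint (fun x => (f x)%:C) v%:C.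
Proof. by move=> fv; split => //=; exact: has_int0. Qed.

(** The exponent z = 0 left out of [has_cint_xpow]. It occurs on the diagonal of the squared norm of
    the test function and produces the logarithm there. *)
Lemma has_cint_inv e y (b : bool) : 0 < e -> e <= y ->
  has_cint (fun x => ind e b y x * xpow x (-1)) (ln y - ln e)%:C.
Proof.
move=> e0 ey.
have xpos x : e <= x -> 0 < x by exact: lt_le_trans.
have dV x : e <= x -> derivable (fun t : R => t^-1) x 1.
  by move=> /xpos x0; apply: derivableV => //; rewrite gt_eqF.
have := has_int_FTC b (ltW e0) ey (fun x ex => is_derive1_ln (xpos x ex)) dV.
move=> /has_cint_real; apply: has_cint_eq => x x0.
by rewrite xpowN1// rmorphM.
Qed.

Lemma has_cint_ind y (b : bool) : 0 <= y -> has_cint (ind 0 b y) y%:C.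
Proof.
move=> y0; apply: has_cint_real.
have := has_int_FTC (f := cst 1) b (lexx 0) y0
  (fun x _ => is_derive_id x 1) (fun x _ => derivable_cst _ _ _).
by rewrite subr0; apply: has_int_eq => x _; rewrite mulr1.
Qed.

End ComplexPower.

(** * The test function and its squared norm *)

Section DualFunction.
Variable R : realType.
Implicit Types (x y e g h : R) (z w : R[i]) (s : seq R).

Lemma mulc_conjc z : z * conjc z = (normc z ^+ 2)%:C.
Proof.
case: z => a b /=; rewrite sqr_sqrtr ?addr_ge0 ?sqr_ge0//.
by apply/eqP; rewrite eq_complex /=; apply/andP; split; apply/eqP; ring.
Qed.

Lemma normc_ge0 z : 0 <= normc z.
Proof. by case: z => a b /=; exact: sqrtr_ge0. Qed.

Lemma Re_le_normc z : complex.Re z <= normc z.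
Proof.
case: z => a b /=; apply: le_trans (ler_norm a) _.
by rewrite -sqrtr_sqr ler_wsqrtr// lerDl sqr_ge0.
Qed.

Lemma normc_sum (I : Type) (r : seq I) (F : I -> R[i]) :
  normc (\sum_(i <- r) F i) <= \sum_(i <- r) normc (F i).
Proof.
elim/big_ind2 : _ => [|u a v b ua vb|//].
  by rewrite ComplexField.Normc.normc0.
exact: le_trans (le_normcD _ _) (lerD ua vb).
Qed.

Lemma normc_real x : 0 <= x -> normc x%:C = x.
Proof. by move=> x0; rewrite /= expr0n addr0 sqrtr_sqr ger0_norm. Qed.

Lemma sqr_normc_xpow x z : 0 < x -> normc (xpow x z) ^+ 2 = x `^ (2 * complex.Re z).
Proof. by move=> x0; have := mulc_conjc (xpow x z); rewrite xpow_conjM// => /complexI. Qed.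

(** This is rho - r + 1/2 for the zero rho = r + i g, so [weight g] is the term of that zero in
    C. *)
Definition halfline g : R[i] := 2^-1 +i* g.
Local Notation q := halfline.

Lemma halfline_neq0 g : q g != 0.
Proof. by rewrite eq_complex /= negb_and invr_eq0 pnatr_eq0. Qed.

Definition weight g : R := (normc (q g) ^+ 2)^-1.

Lemma weight_ge0 g : 0 <= weight g.
Proof. by rewrite invr_ge0 sqr_ge0. Qed.

Lemma weightE g : (weight g)%:C = (q g)^-1 * (conjc (q g))^-1.
Proof. by rewrite -invfM mulc_conjc -fmorphV. Qed.

(** The antiderivative, vanishing at 0, of the untruncated sum of x^(q-1) / conj(q). *)
Definition dual_prim s y : R[i] := \sum_(g <- s) (weight g)%:C * xpow y (q g).

(* This is the complex conjugate of the test function. Its constant value on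
   ]0, e] makes its integral over ]0, y] equal to [dual_prim s y] without a
   boundary term at e. *)
Definition dual s e x : R[i] := ind 0 false e x * (dual_prim s e / e%:C) +
  ind e false 1 x * \sum_(g <- s) (conjc (q g))^-1 * xpow x (q g - 1).

(** The hypothesis concerns the single point [x], so 0 < x can be used when intersecting
    intervals. *)
Lemma indic_itvM (I J K : interval R) x :
  (x \in I) && (x \in J) = (x \in K) ->
  ((\1_[set` I] x)%:C : R[i]) * (\1_[set` J] x)%:C = (\1_[set` K] x)%:C.
Proof.
move=> IJK; rewrite -rmorphM !indicE -natrM mulnb; congr (_%:R%:C).
have E (L : interval R) : (x \in [set` L]) = (x \in L).
  by apply/idP/idP => [/set_mem//|xL]; exact/mem_set.
by rewrite !E IJK.
Qed.

Lemma has_cint_dual s e y (b : bool) : 0 < e -> e < y -> y <= 1 ->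
  has_cint (fun x => ind 0 b y x * dual s e x) (dual_prim s y).
Proof.
move=> e0 ey y1.
(* The integrals over ]0, e] and ]e, y]; the terms at e cancel because the weight is 1 / (q
   conj(q)). *)
have -> : dual_prim s y = (dual_prim s e / e%:C) * e%:C +
    \sum_(g <- s) (conjc (q g))^-1 * ((xpow y (q g) - xpow e (q g)) / q g).
  rewrite divfK; last by rewrite eq_complex /= negb_and gt_eqF.
  rewrite -big_split/=; apply: eq_bigr => g _.
  by rewrite weightE; ring.
have hs : has_cint (fun x => \sum_(g <- s)
    (conjc (q g))^-1 * (ind e b y x * xpow x (q g - 1)))
    (\sum_(g <- s) (conjc (q g))^-1 * ((xpow y (q g) - xpow e (q g)) / q g)).
  apply: has_cint_sum => g _ _; apply: has_cintZ.
  exact: has_cint_xpow (halfline_neq0 g) e0 (ltW ey).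
apply: has_cint_eq (has_cintD (has_cintZ _ (has_cint_ind false (ltW e0))) hs).
move=> x x0; rewrite /dual mulrDr !mulrA.
rewrite (indic_itvM (K := `]0, e]%R)); last first.
  rewrite !in_itv/= x0/=; case: (leP x e) => xe; rewrite ?andbF// andbT.
  by case: (b); rewrite /= ?ltW// (le_lt_trans xe).
rewrite (indic_itvM (K := Interval (BRight e) (BSide b y))); last first.
  rewrite !in_itv/= x0/= andbCA; congr (_ && _).
  case: (leP x 1) => x1; rewrite ?andbT// andbF; apply/esym/negbTE.
  by case: (b); rewrite /= -?leNgt -?ltNge; [apply/ltW|];
    exact: le_lt_trans x1.
congr (_ + _); first by rewrite -[RHS]mulrA [RHS]mulrC.
by rewrite mulr_sumr; apply: eq_bigr => g _; rewrite mulrCA.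
Qed.

(** The two indicators are idempotent with disjoint supports, so the pieces do not interact. In the
    double sum, (q_g - 1) + conj(q_h - 1) = i(g - h) - 1. *)
Lemma dual_sqr s e x : 0 < x ->
  dual s e x * conjc (dual s e x) =
  ind 0 false e x * ((dual_prim s e / e%:C) * conjc (dual_prim s e / e%:C)) +
  \sum_(g <- s) \sum_(h <- s) ((conjc (q g))^-1 * (q h)^-1) *
    (ind e false 1 x * xpow x (0 +i* (g - h) - 1)).
Proof.
move=> x0; rewrite /dual.
set W := _ / _; set T := (X in _ + _ * X); set i0 := real_complex _ _.
set i1 := real_complex _ (\1_[set` `]e, 1]%R] x).
have i0E : i0 * i0 = i0 by apply: indic_itvM; rewrite andbb.
have i1E : i1 * i1 = i1 by apply: indic_itvM; rewrite andbb.
have i01 : i0 * i1 = 0.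
  (* The interval []0, 0[] stands for the empty intersection. *)
  rewrite (indic_itvM (K := `]0, 0[%R)); last first.
    by rewrite !in_itv/= x0 (lt_gtF x0)/=; case: leP.
  rewrite indicE; case: (boolP (x \in _)) => // /set_mem/=.
  by rewrite in_itv/= (lt_gtF x0) andbF.
have cM w z : conjc (w * z) = conjc w * conjc z by exact: rmorphM.
have TE : T * conjc T = \sum_(g <- s) \sum_(h <- s)
    ((conjc (q g))^-1 * (q h)^-1) * xpow x (0 +i* (g - h) - 1).
  rewrite rmorph_sum big_distrlr; apply: eq_bigr => g _.
  apply: eq_bigr => h _.
  rewrite -[LHS]/(_ * conjc (_ * _)) cM conjc_inv conjcK xpow_conj mulrACA -xpowD.
  congr (_ * xpow _ _).
  apply/eqP; rewrite eq_complex /=; apply/andP; split; apply/eqP; lra.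
transitivity (i0 * (W * conjc W) + i1 * (T * conjc T)); last first.
  congr (_ + _); rewrite TE mulr_sumr; apply: eq_bigr => g _.
  by rewrite mulr_sumr; apply: eq_bigr => h _; rewrite mulrCA.
have -> : conjc (i0 * W + i1 * T) = i0 * conjc W + i1 * conjc T.
  by rewrite rmorphD /= !cM /= oppr0.
have -> : (i0 * W + i1 * T) * (i0 * conjc W + i1 * conjc T) =
   (i0 * i0) * (W * conjc W) + (i1 * i1) * (T * conjc T)
   + (i0 * i1) * (W * conjc T + T * conjc W) by ring.
by rewrite i0E i1E i01 mul0r addr0.
Qed.

Definition weight_sum s : R := \sum_(g <- s) weight g.

Lemma weight_sum_ge0 s : 0 <= weight_sum s.
Proof. by apply: sumr_ge0 => g _; exact: weight_ge0. Qed.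

(** Since Re q = 1/2, each |e^q| is sqrt(e). Hence the constant piece has squared norm |dual_prim s
    e|^2 / e, bounded uniformly in e. *)
Lemma normc_dual_prim s e : 0 < e ->
  normc (dual_prim s e) ^+ 2 <= weight_sum s ^+ 2 * e.
Proof.
move=> e0.
have nx g : normc (xpow e (q g)) = Num.sqrt e.
  apply/eqP; rewrite -(@eqrXn2 _ 2) ?sqrtr_ge0 ?normc_ge0//.
  by rewrite sqr_normc_xpow//= sqr_sqrtr ?(ltW e0)// divff ?pnatr_eq0// powRr1 ?ltW.
rewrite -[X in _ * X](sqr_sqrtr (ltW e0)) -exprMn lerXn2r ?nnegrE ?normc_ge0//.
  by rewrite mulr_ge0 ?sqrtr_ge0// sumr_ge0// => g _; exact: weight_ge0.
apply: le_trans (normc_sum _ _) _; rewrite mulr_suml; apply: ler_sum => g _.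
by rewrite ComplexField.Normc.normcM nx normc_real// weight_ge0.
Qed.

(** Diagonal terms integrate 1/x over ]e, 1] and give -ln e times the weight. For g != h the
    integral is 1 - e^(i(g-h)), of modulus at most 2, divided by i(g-h), so [K] is uniform in e. *)
Lemma dual_sqr_bound s : uniq s -> exists K : R, forall e, 0 < e -> e < 1 ->
  exists2 v : R, has_int (fun x => normc (dual s e x) ^+ 2) v &
    v <= weight_sum s * - ln e + K.
Proof.
move=> us.
pose k g h := 2 * normc ((conjc (q g))^-1 * (q h)^-1 / (0 +i* (g - h))).
(* The first term bounds the piece over ]0, e], the double sum the off-diagonal terms; [k g g] only
   has to be nonnegative. *)
exists (weight_sum s ^+ 2 + \sum_(g <- s) \sum_(h <- s) k g h) => e e0 e1.
pose W := dual_prim s e / e%:C.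
pose I g h : R[i] := if g == h then (ln 1 - ln e)%:C
  else (xpow 1 (0 +i* (g - h)) - xpow e (0 +i* (g - h))) / (0 +i* (g - h)).
have hI g h : has_cint
    (fun x => ind e false 1 x * xpow x (0 +i* (g - h) - 1)) (I g h).
  rewrite /I; case: eqVneq => [->|gh].
    by rewrite subrr sub0r; exact: has_cint_inv (ltW e1).
  apply: has_cint_xpow (ltW e1) => //.
  by rewrite eq_complex /= negb_and subr_eq0 gh orbT.
have hv := has_cintD (has_cintZ (W * conjc W) (has_cint_ind false (ltW e0)))
  (has_cint_sum (s := s) (P := predT) (fun g _ _ =>
    has_cint_sum (s := s) (P := predT) (fun h _ _ =>
      has_cintZ ((conjc (q g))^-1 * (q h)^-1) (hI g h)))).
eexists.
  apply: has_int_eq hv.1 => x x0.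
  rewrite -[RHS]/(complex.Re (normc (dual s e x) ^+ 2)%:C) -mulc_conjc.
  by rewrite dual_sqr// mulrC.
have ReS (I0 : Type) (r : seq I0) (F : I0 -> R[i]) :
    complex.Re (\sum_(i <- r) F i) = \sum_(i <- r) complex.Re (F i).
  by rewrite (big_morph _ (@complexReD R) (erefl (complex.Re (0 : R[i])))).
rewrite complexReD [leRHS]addrCA; apply: lerD.
  rewrite mulc_conjc -rmorphM -[leLHS]/(normc W ^+ 2 * e).
  have -> : normc W = normc (dual_prim s e) / e.
    rewrite /W ComplexField.Normc.normcM ComplexField.Normc.normcV.
    by rewrite normc_real// ltW.
  have -> : (normc (dual_prim s e) / e) ^+ 2 * e = normc (dual_prim s e) ^+ 2 / e.
    by field; rewrite gt_eqF.
  by rewrite ler_pdivrMr//; exact: normc_dual_prim.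
rewrite ReS /weight_sum mulr_suml -big_split/= big_seq [leRHS]big_seq.
apply: ler_sum => g gs.
(* As [s] has no repetitions, h = g occurs exactly once; this allows a termwise comparison over
   h. *)
have -> : weight g * - ln e = \sum_(h <- s) if g == h then weight g * - ln e else 0.
  rewrite (bigD1_seq g)//= eqxx big1 ?addr0// => h /negbTE.
  by rewrite eq_sym => ->.
rewrite ReS -big_split/=; apply: ler_sum => h _.
rewrite /I /k; case: eqVneq => [<-|gh].
  rewrite ln1 sub0r [_^-1 * _]mulrC -weightE -rmorphM/= lerDl.
  by rewrite mulr_ge0 ?normc_ge0.
rewrite add0r; apply: le_trans (Re_le_normc _) _.
rewrite mulrCA ComplexField.Normc.normcM ler_wpM2r ?normc_ge0//.
rewrite xpow1; apply: le_trans (le_normcD _ _) _.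
rewrite normcN ComplexField.Normc.normc1.
have -> : normc (xpow e (0 +i* (g - h))) = 1.
  apply/eqP; rewrite -(@eqrXn2 _ 2) ?ler01 ?normc_ge0//.
  by rewrite sqr_normc_xpow//= mulr0 powRr0 expr1n.
by [].
Qed.

End DualFunction.

(** * Pairing with the error and the lower bound for the distance *)

Section LowerBound.
Variables (R : realType) (m : nat) (a : nat -> R[i]) (r : R).
Implicit Types (x y e g h v : R) (z w : R[i]) (s : seq R).

Definition residual (n : nat) (b : nat -> R[i]) x : R[i] :=
  (\1_(`]0, 1[ : set R) x)%:C
  - \sum_(1 <= k < n.+1) b k * kappa m a r (k%:R * x)^-1.

(** The condition l <= 1/(k x) reads x <= 1/(k l). The factor l^-(r-1/2) becomes an [xpow] so that
    it can later be merged with l^-q. *)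
Lemma kappa_ind (k : nat) x : (0 < k)%N -> 0 < x ->
  kappa m a r (k%:R * x)^-1 =
  \sum_(1 <= l < m.+1) a l * xpow l%:R (- (r - 2^-1)%:C) *
    ind 0 false (k%:R * l%:R)^-1 x.
Proof.
move=> k0 x0; rewrite /kappa big_mkcond/= big_nat_cond [RHS]big_nat_cond.
apply: eq_bigr => l; rewrite andbT => /andP[l0 _].
have kR : 0 < k%:R :> R by rewrite ltr0n.
have lR : 0 < l%:R :> R by rewrite ltr0n.
have -> : (l%:R <= (k%:R * x)^-1) = (x <= (k%:R * l%:R)^-1).
  rewrite -[LHS]ler_pV2 ?inE ?unitfE ?invr_gt0 ?mulr_gt0 ?gt_eqF ?invr_gt0 ?mulr_gt0//.
  rewrite invrK mulrC -ler_pdivlMr// invfM [leRHS]mulrC.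
  by rewrite [_^-1 * _^-1]mulrC.
rewrite indicE -rmorphN xpow_real// powRN fmorphV.
have -> : (x \in [set` `]0, (k%:R * l%:R)^-1]%R]) = (x <= (k%:R * l%:R)^-1).
  by apply/idP/idP; rewrite inE/= in_itv/= x0.
by case: ifP => _; rewrite ?mulr1 ?mulr0.
Qed.

(** Against kappa_r(1/(k x)) the test function yields the sum over g of weight times k^-q P(r + i
    g), because (r - 1/2) + q = r + i g; this vanishes. Only 1_(0,1) contributes, with
    [dual_prim s 1]. *)
Lemma has_cint_residual_dual s (n : nat) (b : nat -> R[i]) :
  (0 < m)%N -> (0 < n)%N ->
  {in s, forall g, dirichlet_poly m a (r +i* g) = 0} ->
  has_cint (fun x => residual n b x * dual s (n * m.+1)%:R^-1 x)
           (weight_sum s)%:C.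
Proof.
move=> m0 n0 sP; set e := _^-1.
have e0 : 0 < e by rewrite invr_gt0 ltr0n muln_gt0 n0.
(* The factor m + 1 in e, rather than m, gives the strict inequality required by [has_cint_dual]. *)
have ekl (k l : nat) : (0 < k)%N -> (k <= n)%N -> (0 < l)%N -> (l <= m)%N ->
    e < (k%:R * l%:R)^-1.
  move=> k0 kn l0 lm; rewrite ltf_pV2 ?posrE ?ltr0n ?muln_gt0 ?n0// -?natrM ?ltr0n ?muln_gt0 ?k0//.
  rewrite ltr_nat; apply: (@leq_ltn_trans (n * m)); first exact: leq_mul.
  by rewrite ltn_pmul2l.
have h1 : has_cint (fun x => ind 0 true 1 x * dual s e x) (dual_prim s 1).
  apply: has_cint_dual => //.
  by have := ekl 1%N 1%N; rewrite mulr1 invr1; exact.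
have hk : has_cint (fun x => \sum_(1 <= k < n.+1) (- b k) *
    \sum_(1 <= l < m.+1) (a l * xpow l%:R (- (r - 2^-1)%:C)) *
       (ind 0 false (k%:R * l%:R)^-1 x * dual s e x))
   (\sum_(1 <= k < n.+1) (- b k) *
    \sum_(1 <= l < m.+1) (a l * xpow l%:R (- (r - 2^-1)%:C)) *
       dual_prim s (k%:R * l%:R)^-1).
  apply: has_cint_sum => k; rewrite mem_index_iota => /andP[k0 kn] _.
  apply: has_cintZ; apply: has_cint_sum => l.
  rewrite mem_index_iota => /andP[l0 lm] _.
  apply: has_cintZ; apply: has_cint_dual => //; first exact: ekl.
  by rewrite -natrM invf_le1 ?ler1n ?ltr0n muln_gt0 k0.
have -> : (weight_sum s)%:C = dual_prim s 1 +
   (\sum_(1 <= k < n.+1) (- b k) *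
    \sum_(1 <= l < m.+1) (a l * xpow l%:R (- (r - 2^-1)%:C)) *
       dual_prim s (k%:R * l%:R)^-1).
  rewrite [X in _ + X]big1_seq ?addr0; last first.
    move=> k /andP[_]; rewrite mem_index_iota => /andP[k0 kn].
    suff -> : \sum_(1 <= l < m.+1) (a l * xpow l%:R (- (r - 2^-1)%:C)) *
       dual_prim s (k%:R * l%:R)^-1 = 0 by rewrite mulr0.
    transitivity (\sum_(1 <= l < m.+1) \sum_(g <- s)
      ((weight g)%:C * xpow k%:R (- halfline g)) *
      (a l * natcpow l (- (r +i* g)))).
      rewrite big_nat_cond [RHS]big_nat_cond.
      apply: eq_bigr => l; rewrite andbT => /andP[l0 _].
      rewrite mulr_sumr; apply: eq_bigr => g _.
      have kR : 0 < k%:R :> R by rewrite ltr0n.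
      have lR : 0 < l%:R :> R by rewrite ltr0n.
      rewrite xpowV ?mulr_gt0// xpowM//.
      have -> : natcpow l (- (r +i* g)) =
          xpow l%:R (- (r - 2^-1)%:C) * xpow l%:R (- halfline g) :> R[i].
        rewrite -[LHS]/(xpow l%:R (- (r +i* g))).
        rewrite (_ : - (r +i* g) = - (r - 2^-1)%:C + - halfline g) ?xpowD//.
        by apply/eqP; rewrite eq_complex /=; apply/andP; split; apply/eqP; lra.
      by ring.
    rewrite exchange_big/= big1_seq// => g /andP[_ gs].
    by rewrite -mulr_sumr -/(dirichlet_poly m a (r +i* g)) sP// mulr0.
  rewrite /weight_sum rmorph_sum; apply: eq_bigr => g _.
  by rewrite xpow1 mulr1.
apply: has_cint_eq (has_cintD h1 hk) => x x0.
rewrite /residual mulrBl -mulNr -sumrN mulr_suml; congr (_ + _).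
rewrite big_nat_cond [RHS]big_nat_cond.
apply: eq_bigr => k; rewrite andbT => /andP[k0 _].
rewrite kappa_ind// -mulNr -mulrA mulr_suml; congr (_ * _).
by apply: eq_bigr => l _; rewrite mulrA.
Qed.

Lemma sq_error_ge s (n : nat) (b : nat -> R[i]) v (t : R) :
  (0 < m)%N -> (0 < n)%N ->
  {in s, forall g, dirichlet_poly m a (r +i* g) = 0} ->
  has_int (fun x => normc (dual s (n * m.+1)%:R^-1 x) ^+ 2) v ->
  ((2 * t * weight_sum s - t ^+ 2 * v)%:E <= sq_error m a r n b)%E.
Proof.
move=> m0 n0 sP hv.
have [hr _] := has_cint_residual_dual b m0 n0 sP.
have := has_intD (has_intZ (2 * t) hr) (has_intZ (- t ^+ 2) hv).
rewrite mulNr => /has_int_le_integral; apply=> [x|x x0]; first exact: sqr_ge0.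
rewrite -/(residual n b x).
case: (residual n b x) (dual _ _ x) => [u1 u2] [w1 w2] /=.
rewrite !sqr_sqrtr ?addr_ge0 ?sqr_ge0// -subr_ge0.
(* With u the residual and w the value of [dual], this is |u - t conj(w)|^2. *)
have -> : u1 ^+ 2 + u2 ^+ 2 -
    (2 * t * (u1 * w1 - u2 * w2) + - t ^+ 2 * (w1 ^+ 2 + w2 ^+ 2)) =
    (u1 - t * w1) ^+ 2 + (u2 + t * w2) ^+ 2 by ring.
by rewrite addr_ge0 ?sqr_ge0.
Qed.

Lemma approx_dist_sqr_ge s : (0 < m)%N -> uniq s ->
  {in s, forall g, dirichlet_poly m a (r +i* g) = 0} ->
  exists2 M : R, 0 < M & forall n, (0 < n)%N ->
    ((weight_sum s ^+ 2 / (weight_sum s * ln n%:R + M))%:E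
      <= approx_dist m a r n ^+ 2)%E.
Proof.
move=> m0 us sP; have [K hK] := dual_sqr_bound us.
set C := weight_sum s; have C0 : 0 <= C := weight_sum_ge0 s.
have lm : 0 <= ln m.+1%:R :> R by rewrite ln_ge0// ler1n.
(* The first term comes from -ln e = ln n + ln(m+1); the maximum with 1 keeps the denominator
   positive even when C = 0 or n = 1. *)
exists (C * ln m.+1%:R + Num.max K 1).
  by rewrite ltr_wpDl ?mulr_ge0// lt_max ltr01 orbT.
move=> n n0.
have nR : 0 < n%:R :> R by rewrite ltr0n.
set e : R := (n * m.+1)%:R^-1.
have e0 : 0 < e by rewrite invr_gt0 ltr0n muln_gt0 n0.
have e1 : e < 1.
  rewrite invf_lt1 ?ltr0n ?muln_gt0 ?n0// ltr1n.
  by rewrite (leq_trans _ (leq_pmull _ n0)).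
have [v hv vK] := hK e e0 e1.
have lnE : - ln e = ln n%:R + ln m.+1%:R.
  by rewrite lnV ?posrE ?ltr0n ?muln_gt0 ?n0// opprK natrM lnM ?posrE ?ltr0n.
set L := C * ln n%:R + _.
have ln0 : 0 <= ln n%:R :> R by rewrite ln_ge0// ler1n.
have L0 : 0 < L.
  by rewrite /L !ltr_wpDl ?mulr_ge0// lt_max ltr01 orbT.
have vL : v <= L.
  apply: le_trans vK _; rewrite lnE -/C mulrDr /L addrA lerD2l.
  by rewrite le_max lexx.
rewrite approx_dist_sqr; apply: le_ereal_inf_tmp => _ [b _ <-].
(* The choice t = C / L maximizes 2 t C - t^2 L, with value C^2 / L. *)
apply: le_trans (sq_error_ge b (C / L) m0 n0 sP hv).
rewrite lee_fin -/C; apply: (@le_trans _ _ (2 * (C / L) * C - (C / L) ^+ 2 * L)).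
  by rewrite le_eqVlt; apply/orP; left; apply/eqP; field; rewrite gt_eqF.
by rewrite lerD2l lerN2 ler_wpM2l ?sqr_ge0.
Qed.

Lemma weight_sum_le_limn_einf s : (0 < m)%N -> uniq s ->
  {in s, forall g, dirichlet_poly m a (r +i* g) = 0} ->
  ((weight_sum s)%:E <=
   limn_einf (fun n => approx_dist m a r n ^+ 2 * (ln n%:R)%:E))%E.
Proof.
move=> m0 us sP; have [M M0 hM] := approx_dist_sqr_ge m0 us sP.
set C := weight_sum s; have C0 : 0 <= C := weight_sum_ge0 s.
apply/lee_subgt0Pr => d d0.
(* From this index on n exceeds e^(M/d), so ln n >= M/d; the successor ensures n > 0. *)
apply: (@limn_einf_ge _ _ _ (Num.bound (expR (M / d))).+1) => n Nn.
have n0 : (0 < n)%N by exact: leq_ltn_trans Nn.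
have Mn : M / d <= ln n%:R.
  rewrite -ler_expR lnK ?posrE ?ltr0n//.
  apply/ltW/(lt_le_trans (archi_boundP (expR_ge0 _))).
  by rewrite ler_nat ltnW.
have ln0 : 0 <= ln n%:R :> R by rewrite ln_ge0// ler1n.
apply: (@le_trans _ _ ((C ^+ 2 / (C * ln n%:R + M))%:E * (ln n%:R)%:E)%E).
  rewrite -EFinM lee_fin mulrAC ler_pdivlMr ?ltr_wpDl ?mulr_ge0//.
  move: Mn; rewrite ler_pdivrMr// => Mn.
  (* With u = ln n, the goal (C - d)(C u + M) <= C^2 u follows from C M <= C u d and 0 < M d. *)
  have := ler_wpM2l C0 Mn; have := mulr_gt0 M0 d0.
  move: (ln n%:R) => u. nra.
by apply: lee_wpmul2r; [rewrite lee_fin|exact: hM].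
Qed.

End LowerBound.

(** * From finite families of zeros to the full sum *)

Theorem theorem2 (R : realType) (m : nat) (hm : (0 < m)%N)
    (a : nat -> R[i]) (ha1 : a 1%N != 0) (r : R) :
  (zero_const m a r
     <= limn_einf (fun n : nat => approx_dist m a r n ^+ 2 * (ln (n%:R : R))%:E))%E.
Proof.
(* The unordered sum is the supremum of its finite partial sums, so one finite set [A] of zeros is
   treated at a time. *)
apply: ge_ereal_sup => _ [A [fA AZ] <-].
pose s := [seq complex.Im rho | rho <- finmap.enum_fset (fset_set A)].
have sP : {in s, forall g, dirichlet_poly m a (r +i* g) = 0}.
  move=> _ /mapP[[x y] + ->]; rewrite in_fset_set// inE => /AZ[P0 /= xr].
  by rewrite -xr.
(* Zeros on the line share the real part r, so distinct zeros have distinct imaginary parts. *)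
have us : uniq s.
  rewrite map_inj_in_uniq ?finmap.fset_uniq// => -[x y] [x' y'].
  rewrite !in_fset_set// !inE => /AZ[_ /= ->] /AZ[_ /= ->] ->.
  by [].
suff -> : (\sum_(rho \in A) ((ComplexField.Normc.normc
    (rho - r%:C + (2^-1)%:C) ^+ 2)^-1)%:E)%E = (weight_sum s)%:E.
  exact: weight_sum_le_limn_einf.
rewrite fsbig_finite//= sumEFin /weight_sum big_map; congr EFin.
rewrite big_seq [RHS]big_seq; apply: eq_bigr => -[x y].
rewrite in_fset_set// inE => /AZ[_ /= ->].
by rewrite /weight /halfline /= subrr add0r subr0 addr0.
Qed.
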